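(* Let $\mathcal G$ be a connected simple graph with vertex set $n=\{0,1,\ldots,n-1\}$, $n\ge 3$, having a vertex of degree $1$. Then $\mathcal G$ is not perm-complete. Consequently, no tree having three or more vertices is perm-complete.
   Context: Permutations in $\mathrm{Sym}(n)$ compose left to right. For a finite sequence $\mathbf s$ in $\mathrm{Sym}(n)$, $\bigcirc\mathbf s$ is the composite of its terms in order, $\mathrm{Seq}(\mathbf s)$ the set of its rearrangements and $\mathrm{Prod}(\mathbf s)=\{\bigcirc\mathbf r:\mathbf r\in\mathrm{Seq}(\mathbf s)\}$; $\mathbf s$ is perm-complete iff $\mathrm{Prod}(\mathbf s)$ is $\mathrm{Alt}(n)$ or $\mathrm{Sym}(n)\setminus\mathrm{Alt}(n)$. A simple graph on vertex set $n$ is perm-complete iff it is isomorphic to the graph whose edges are the terms of some perm-complete sequence $\mathbf u$ of pairwise distinct transpositions in $\mathrm{Sym}(n)$ (an edge $(x\,y)$ corresponding to the transposition $(x\,y)$). *)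

(* Defs.v *)
From mathcomp Require Import all_boot all_fingroup all_solvable.

Set Implicit Arguments.
Unset Strict Implicit.
Unset Printing Implicit Defensive.

Local Open Scope group_scope.

(* The product of {perm T} is left-to-right composition: (s * t) x = t (s x). *)
Definition composite (n : nat) (s : seq 'S_n) : 'S_n := \prod_(g <- s) g.

Definition Seq (n : nat) (s : seq 'S_n) : seq (seq 'S_n) := permutations s.

Definition Prod (n : nat) (s : seq 'S_n) : {set 'S_n} :=
  [set g | g \in [seq composite r | r <- Seq s]].

Definition perm_complete_seq (n : nat) (s : seq 'S_n) : Prop :=
  Prod s = 'Alt_('I_n) \/ Prod s = 'Sym_('I_n) :\: 'Alt_('I_n).

Definition is_transposition (n : nat) (g : 'S_n) : Prop :=
  exists x y : 'I_n, x != y /\ g = tperm x y.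

Definition simple_graph (T : finType) (e : rel T) : Prop :=
  symmetric e /\ irreflexive e.

Definition graph_iso (T1 T2 : finType) (e1 : rel T1) (e2 : rel T2) : Prop :=
  exists f : T1 -> T2, bijective f /\ forall x y, e2 (f x) (f y) = e1 x y.

Definition transposition_graph (n : nat) (u : seq 'S_n) : rel 'I_n :=
  fun x y => (x != y) && (tperm x y \in u).

Definition perm_complete_graph (n : nat) (e : rel 'I_n) : Prop :=
  exists u : seq 'S_n,
    [/\ forall g, g \in u -> is_transposition g,
        uniq u,
        perm_complete_seq u
      & graph_iso e (transposition_graph u)].

Definition graph_connected (T : finType) (e : rel T) : Prop :=
  forall x y : T, connect e x y.

Definition vertex_degree (T : finType) (e : rel T) (v : T) : nat :=
  #|[set w | e v w]|.

(* In path.v's convention an edge x - y traversed back and forth is the e-cycle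
   [:: x; y], so cycles of a simple graph are those of length at least 3. *)
Definition acyclic (T : finType) (e : rel T) : Prop :=
  forall c : seq T, ucycle e c -> size c < 3.

Definition is_tree (T : finType) (e : rel T) : Prop :=
  [/\ simple_graph e, graph_connected e & acyclic e].

(* Main.v *)
Require Import Defs.
From mathcomp Require Import all_boot all_fingroup all_solvable.

(** Let [v] be a leaf of the graph and [t] the only term of the sequence that
    moves [v]. Every rearrangement composes to [a * t * b] where [a] and [b] fix
    [v]; this sends [v] to [b (t v)], which differs from [b v = v]. So no
    composite fixes [v], whereas both the identity and a transposition of two
    other vertices do, and these have opposite parities. A tree has a leaf, since
    otherwise simple paths could be prolonged indefinitely. *)

Set Implicit Arguments.
Unset Strict Implicit.
Unset Printing Implicit Defensive.

Lemma perm_prod_fix (T : finType) (r : seq {perm T}) (v : T) :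
  {in r, forall g : {perm T}, g v = v} -> (\prod_(g <- r) g)%g v = v.
Proof.
elim: r => [|g r IHr] fixr; first by rewrite big_nil perm1.
rewrite big_cons permM fixr ?mem_head // IHr // => h hr.
by rewrite fixr // inE hr orbT.
Qed.

(** Since [r] has no repeats, [t] lies in neither of the two stretches around it, so both stretches
    fix [v]. *)
Lemma perm_prod_moves (T : finType) (r : seq {perm T}) (t : {perm T}) (v : T) :
    uniq r -> t \in r -> t v != v ->
    {in r, forall g : {perm T}, g != t -> g v = v} ->
  (\prod_(g <- r) g)%g v != v.
Proof.
move=> uniq_r t_in tv fixr; case/splitPr: t_in uniq_r fixr => r1 r2.
rewrite cat_uniq /= negb_or => /and4P[_ /andP[t_r1 _] t_r2 _] fixr.
have fix1: {in r1, forall g : {perm T}, g v = v}.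
  move=> g gr1; apply: fixr; first by rewrite mem_cat gr1.
  by apply: contraNneq t_r1 => <-.
have fix2: {in r2, forall g : {perm T}, g v = v}.
  move=> g gr2; apply: fixr; first by rewrite mem_cat inE gr2 !orbT.
  by apply: contraNneq t_r2 => <-.
rewrite big_cat big_cons /= !permM (perm_prod_fix fix1).
by apply: contra_neq tv; rewrite -{2}(perm_prod_fix fix2) => /perm_inj.
Qed.

Lemma leaf_not_perm_complete (n : nat) (e : rel 'I_n) (v : 'I_n) :
  2 < n -> vertex_degree e v = 1 -> ~ perm_complete_graph e.
Proof.
move=> n_gt2 /eqP/cards1P[w Nv] [u [tr_u uniq_u comp_u [f [[g fK gK] fe]]]].
have Ne x : e v x = (x == w) by rewrite -in_set1 -Nv inE.
have moved h : h \in Prod u -> h (f v) != f v.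
  rewrite inE => /mapP[r]; rewrite mem_permutations => r_u ->.
  have := fe v w; rewrite Ne eqxx => /andP[neq_vw t_u].
  apply: (perm_prod_moves (t := tperm (f v) (f w))).
  - by rewrite (perm_uniq r_u).
  - by rewrite (perm_mem r_u).
  - by rewrite tpermL eq_sym.
  (* Pulled back through [g], such a [z] is a neighbour of the leaf [v], hence equals [w]. *)
  have only_w z : f v != z -> tperm (f v) z \in u -> z = f w.
    move=> vz uz; have := fe v (g z).
    by rewrite gK Ne /transposition_graph vz uz => /esym/eqP <-; rewrite gK.
  move=> h'; rewrite (perm_mem r_u) => hu ht.
  have [x [y [xy def_h]]] := tr_u _ hu; rewrite def_h in hu ht *.
  have [eqx|nx] := eqVneq (f v) x.
    by rewrite -eqx in xy hu ht; rewrite (only_w y) ?eqxx in ht.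
  have [eqy|ny] := eqVneq (f v) y.
    by rewrite -eqy tpermC eq_sym in xy hu ht *; rewrite (only_w x) ?eqxx in ht.
  by rewrite tpermD // eq_sym.
case: comp_u => def_u.
  by have := moved 1%g; rewrite def_u group1 perm1 eqxx => /(_ isT).
(* Odd case: at least two vertices differ from [f v], and their transposition is odd and fixes
   [f v]. *)
have /card_gt1P[x [y [xv yv xy]]]: 1 < #|[set~ f v]|.
  by rewrite cardsC1 card_ord -ltnS prednK // (ltn_trans _ n_gt2).
rewrite !inE in xv yv.
have := moved (tperm x y); rewrite def_u in_setD Alt_even odd_tperm xy in_setT.
by rewrite tpermD // eqxx => /(_ isT).
Qed.

Lemma connected_neighbour (T : finType) (e : rel T) (x : T) :
  1 < #|T| -> graph_connected e -> exists y, e x y.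
Proof.
move=> T_gt1 conn_e.
have /card_gt0P[y]: 0 < #|[set~ x]| by rewrite cardsC1 -ltnS prednK // ltnW.
rewrite !inE => yx; case/connectP: (conn_e x y) => [[|z p]] /=.
  by move=> _ eq_yx; rewrite eq_yx eqxx in yx.
by case/andP=> xz _ _; exists z.
Qed.

Lemma tree_has_leaf (T : finType) (e : rel T) :
  1 < #|T| -> is_tree e -> exists v, vertex_degree e v = 1.
Proof.
move=> T_gt1 [[sym_e irr_e] conn_e acyc_e].
have [/existsP[v /eqP]|/existsPn no_leaf] :=
  boolP [exists v, vertex_degree e v == 1]; first by exists v.
(* Connectivity gives degree at least 1 and the absence of leaves excludes 1, so two neighbours
   exist and one avoids [z]. *)
have other_neighbour x z : exists2 y, e x y & y != z.
  have deg2: 1 < #|[set w | e x w]|.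
    rewrite ltn_neqAle eq_sym no_leaf; have [y xy] := connected_neighbour x T_gt1 conn_e.
    by apply/card_gt0P; exists y; rewrite inE.
  case/card_gt1P: deg2 => a [b []]; rewrite !inE => xa xb ab.
  have [eq_az|] := eqVneq a z; last by exists a.
  by exists b => //; rewrite eq_sym -eq_az.
have long_path k : exists x p, [/\ uniq (x :: p), path e x p & size p = k].
  elim: k => [|k [x [p [uniq_p path_p size_p]]]].
    by case/card_gt0P: (ltnW T_gt1) => x _; exists x, [::].
  (* The path grows at its start [x], without turning back to its second vertex. For empty [p] the
     default [x] of [head] is harmless, as [e] is irreflexive. *)
  have [y xy y_head] := other_neighbour x (head x p).
  suff y_new: y \notin x :: p.
    exists y, (x :: p); split; last by rewrite /= size_p.
      by rewrite cons_uniq y_new.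
    by rewrite /= sym_e xy.
  rewrite inE negb_or; apply/andP; split.
    by apply: contraTneq xy => ->; rewrite irr_e.
  case: p uniq_p path_p y_head {size_p} => //= z q uniq_q path_q y_z.
  rewrite inE negb_or y_z /=; apply/negP => y_q.
  case/splitPr: y_q uniq_q path_q => q1 q2 uniq_q path_q.
  (* Closing the path at [y] gives the cycle x, z, q1, y. *)
  suff /acyc_e: ucycle e [:: x, z & rcons q1 y] by rewrite /= size_rcons.
  apply/andP; split.
    move: path_q; rewrite /= rcons_path last_rcons (sym_e y) xy andbT.
    by rewrite -cat_rcons cat_path => /and3P[-> ->].
  move: uniq_q; rewrite -cat_rcons -!cat_cons.
  (* The unfolded conjunction is refolded into [uniq] of a concatenation, to discard [q2]. *)
  by rewrite -[_ && _]/(uniq ([:: x, z & rcons q1 y] ++ q2)) cat_uniq => /andP[].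
(* A simple path with [#|T|] edges would have [#|T|.+1] distinct vertices. *)
have [x [p [uniq_p _ size_p]]] := long_path #|T|.
have := max_card (mem (x :: p)).
by rewrite (card_uniqP uniq_p) /= size_p ltnn.
Qed.

Theorem theorem2p2 :
  (forall (n : nat) (e : rel 'I_n),
      3 <= n ->
      simple_graph e ->
      graph_connected e ->
      (exists v : 'I_n, vertex_degree e v = 1) ->
      ~ perm_complete_graph e)
  /\
  (forall (n : nat) (e : rel 'I_n),
      3 <= n ->
      is_tree e ->
      ~ perm_complete_graph e).
Proof.
split=> n e n_ge3; first by move=> _ _ [v]; apply: leaf_not_perm_complete.
move=> /tree_has_leaf[|v]; first by rewrite card_ord ltnW.
exact: leaf_not_perm_complete.
Qed.
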